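(* Let $T$ be a tree on $n$ vertices and let $\lambda\vdash n$. Then the coefficient of $e_\lambda$ in the expansion of the chromatic symmetric function $X_T$ in the basis of elementary symmetric functions is \[ [e_{\lambda}]X_T = \sum_{\mu \dashv \lambda} (-1)^{\ell(\lambda)-\ell(\mu)}\, b_{\mu}\, w(B_{\lambda,\mu}), \] where the sum is over all partitions $\mu$ of $n$ such that $\lambda$ is a refinement of $\mu$ (including $\mu=\lambda$), and $b_\mu$ is the number of connected partitions of $T$ of type $\mu$.
   Context: Chromatic symmetric function: for a graph $G$ with vertices $v_1,\dots,v_n$, $X_G=\sum_\kappa x_{\kappa(v_1)}\cdots x_{\kappa(v_n)}$, the sum over all proper colorings $\kappa:V(G)\to\{1,2,\dots\}$ (i.e. $\kappa(u)\ne\kappa(v)$ for each edge $uv$). For a partition $\lambda=(\lambda_1,\dots,\lambda_\ell)$, $e_\lambda=e_{\lambda_1}\cdots e_{\lambda_\ell}$ with $e_k=\sum_{j_1<\cdots<j_k}x_{j_1}\cdots x_{j_k}$. The $e_\lambda$ ($\lambda\vdash n$) form a basis of the homogeneous symmetric functions of degree $n$, and $[e_\lambda]X$ is the coefficient of $e_\lambda$ in $X$. Partitions: $\lambda\vdash n$ means $\lambda$ is an integer partition of $n$ (order of parts is irrelevant); $\ell(\lambda)$ is its number of parts. Write $\mu\dashv\lambda$ (equivalently $\lambda\vdash\mu$) if $\lambda$ is a refinement of $\mu$, i.e. $\lambda$ can be obtained from $\mu$ by splitting parts of $\mu$ (possibly splitting none, so $\lambda$ refines itself). Connected partitions: a connected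 partition of a graph $G$ is a set partition $\{B_1,\dots,B_k\}$ of $V(G)$ such that each $B_i$ induces a connected subgraph; its type is the integer partition formed by $|B_1|,\dots,|B_k|$. $b_\mu$ is the number of connected partitions of type $\mu$. Brick tabloids: a brick tabloid of shape $\mu$ and content $\lambda$ is the Young diagram of $\mu$ (with $\mu_i$ left-justified boxes in the $i$-th row) with each row divided into bricks, each brick consisting of one or more consecutive boxes of that row, such that the multiset of lengths of all bricks is the multiset of parts of $\lambda$. $B_{\lambda,\mu}$ is the set of all such brick tabloids. The weight $w(T')$ of a brick tabloid $T'$ is the product over its rows of the length of the last (rightmost) brick in the row, and $w(B_{\lambda,\mu})=\sum_{T'\in B_{\lambda,\mu}}w(T')$. *)

(* Defs.v *)
From HB Require Import structures.
From mathcomp Require Import all_boot all_order all_algebra finmap monalg.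
From mathcomp Require Import boolp classical_sets functions cardinality fsbigop.

Set Implicit Arguments.
Unset Strict Implicit.
Unset Printing Implicit Defensive.

Import Order.TTheory GRing.Theory Num.Theory.
Local Open Scope classical_set_scope.
Local Open Scope ring_scope.

(** * Integer partitions *)

(* Parts are listed in weakly decreasing order, so that an integer partition
   has exactly one representative. *)
Definition is_partn (n : nat) (s : seq nat) : bool :=
  [&& sorted geq s, 0%N \notin s & sumn s == n].

Record intpartn (n : nat) : predArgType := IntPartn {
  intpartn_val :> seq nat;
  _ : is_partn n intpartn_val }.

HB.instance Definition _ n := [isSub for @intpartn_val n].
HB.instance Definition _ n := [Countable of intpartn n by <:].

Section IntPartnFinite.
Variable n : nat.

Definition bseq_of_intpartn (la : intpartn n) : n.-bseq 'I_n.+1 :=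
  insub_bseq n [seq inord i | i <- la].

Definition intpartn_of_bseq (b : n.-bseq 'I_n.+1) : option (intpartn n) :=
  insub [seq val i | i <- b].

Lemma size_intpartn (la : intpartn n) : (size la <= n)%N.
Proof.
case: la => s /= /and3P[_ s0 /eqP <-].
elim: s s0 => //= x s IH; rewrite inE negb_or eq_sym -lt0n => /andP[x0 /IH].
by rewrite -add1n; apply: leq_add.
Qed.

Lemma intpartn_le (la : intpartn n) i : i \in (la : seq nat) -> (i <= n)%N.
Proof.
case: la => s /= /and3P[_ _ /eqP <-].
elim: s => //= x s IH; rewrite inE => /orP[/eqP ->|/IH]; first exact: leq_addr.
by move=> /leq_trans; apply; exact: leq_addl.
Qed.

Lemma bseq_of_intpartnK : pcancel bseq_of_intpartn intpartn_of_bseq.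
Proof.
move=> la; rewrite /intpartn_of_bseq /bseq_of_intpartn.
rewrite /insub_bseq insubdK; last first.
  by rewrite unfold_in size_map size_intpartn.
rewrite -map_comp (_ : map _ la = la) ?valK//.
rewrite -[RHS]map_id; apply/eq_in_map => i ila /=.
by rewrite inordK// ltnS (intpartn_le ila).
Qed.

HB.instance Definition _ :=
  isFinite.Build (intpartn n) (pcan_enumP bseq_of_intpartnK).

End IntPartnFinite.

(* The rows of [ss] split the respective parts of [mu] into the parts of [la],
   which are positive when [la] is a partition. *)
Definition splits (la mu : seq nat) (ss : seq (seq nat)) : bool :=
  (map sumn ss == mu) && perm_eq (flatten ss) la.

Definition refines (la mu : seq nat) : Prop := exists ss, splits la mu ss.

(** * Brick tabloids *)

(* A row divided into bricks is the sequence of its brick lengths, read from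
   left to right; a tabloid is the sequence of its rows. *)
Definition brick_tabloids (la mu : seq nat) : set (seq (seq nat)) :=
  [set t | splits la mu t].

Definition brick_weight (t : seq (seq nat)) : nat :=
  (\prod_(r <- t) last 0 r)%N.

Definition total_brick_weight (la mu : seq nat) : int :=
  \sum_(t \in brick_tabloids la mu) (brick_weight t)%:Z.

(** * Trees and connected partitions *)

Section Graphs.
Variables (V : finType) (e : rel V).

Definition is_tree : Prop :=
  [/\ symmetric e, irreflexive e, (0 < #|V|)%N,
      forall u v, connect e u v
    & forall c : seq V, (2 < size c)%N -> ~ ucycle e c].

Definition induces_connected (B : {set V}) : bool :=
  [forall u in B, forall v in B,
     connect [rel x y | [&& x \in B, y \in B & e x y]] u v].

Definition connected_partition (P : {set {set V}}) : bool :=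
  finset.partition P [set: V]%SET && [forall B in P, induces_connected B].

Definition num_connected_partitions (mu : seq nat) : nat :=
  #|[set P : {set {set V}} |
      connected_partition P && perm_eq [seq #|B| | B : {set V} in P] mu]%SET|.

End Graphs.

(** * Symmetric functions *)

(* Formal power series in countably many variables [x_0, x_1, ...] are given by
   their coefficients; [{cmonom nat}] is the type of monomials in these
   variables, [ucm i] being the variable [x_i]. *)
Notation fps := ({cmonom nat} -> int).

(* The formal sum of the monomials [f i] for [i] in [A]; it is meaningful only
   if every monomial is the image of finitely many elements of [A]. *)
Definition formal_sum (I : choiceType) (A : set I) (f : I -> {cmonom nat}) :
    fps :=
  fun m => \sum_(i \in [set i | A i /\ f i = m]) (1 : int).

Definition fps_one : fps := fun m => (m == mone)%:R.

Definition fps_mul (F G : fps) : fps := fun m =>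
  \sum_(p \in [set p : {cmonom nat} * {cmonom nat} | mmul p.1 p.2 = m])
     F p.1 * G p.2.

Definition elem_sym (k : nat) : fps :=
  formal_sum [set j : k.-tuple nat | sorted ltn j]
             (fun j => \big[mmul/mone]_(i <- j) ucm i).

Definition elem_sym_part (la : seq nat) : fps :=
  \big[fps_mul/fps_one]_(k <- la) elem_sym k.

Definition chromatic_sym (V : finType) (e : rel V) : fps :=
  formal_sum [set kappa : {ffun V -> nat} |
                forall u v, e u v -> kappa u <> kappa v]
             (fun kappa => \big[mmul/mone]_v ucm (kappa v)).

Definition elem_expansion (n : nat) (F : fps) (c : {ffun intpartn n -> int}) :
    Prop :=
  forall m, F m = \sum_(la : intpartn n) c la * elem_sym_part la m.

(* [elem_coef F la] is [e_la]F for [F] homogeneous symmetric of degree [n]: the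
   [e_la] being a basis, [F] has exactly one expansion, which [xget] selects.
   If [F] has no expansion, the coefficients are 0 by convention. *)
Definition elem_coef (n : nat) (F : fps) (la : intpartn n) : int :=
  xget [ffun=> 0] [set c | elem_expansion F c] la.

(* Main.v *)
Require Import Defs.
From mathcomp Require Import classical_sets fsbigop.
From mathcomp Require Import all_boot all_order all_algebra.
From mathcomp Require Import boolp.
From mathcomp Require Import finmap monalg mpoly.

Set Implicit Arguments.
Unset Strict Implicit.
Unset Printing Implicit Defensive.

Import Order.TTheory GRing.Theory Num.Theory.
Local Open Scope ring_scope.

(** The proof expands the chromatic symmetric function of the tree in power sums,
    and then every product of power sums in elementary symmetric functions.

    _Power sums._  Fix a coloring [kappa], proper or not, and sum the signs
    (-1)^(n + |P|) over the connected partitions [P] all of whose blocks are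
    monochromatic ([mono_sum]).  If [kappa] is proper, such a block cannot contain
    an edge, so only the partition into singletons occurs and the sum is 1.  If
    some edge [uv] is monochromatic, the sum is 0, by a sign-reversing involution
    ([toggleP]): if [u] and [v] lie in one block, cut it along [uv]; otherwise
    merge the two blocks.  Because removing [uv] disconnects the tree
    ([cut_edge_separates]), the cut leaves exactly two connected pieces, and the
    two operations are inverse to each other.  Weighting each coloring by its
    monomial and exchanging the sums gives X_T as the sum over [mu] of
    (-1)^(n + l(mu)) b_mu p_mu ([chromatic_psum]), since the colorings that are
    constant on the blocks of [P] contribute the product of the p_|B|.

    _Elementary functions._  Newton's identity ([newton]) expresses p_k through
    the products e_j p_(k - j); unfolding it peels off bricks from the left and
    ends with a term k e_k, whose factor k is the length of the last brick.  So
    p_k is the signed sum of last(a) e_a over the compositions [a] of [k]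
    ([compositions_sum]), and for p_mu these compositions become the rows of a
    brick tabloid of shape [mu] ([tabloids_sum], [psum_esum]).  The two signs
    multiply to (-1)^(l(lambda) - l(mu)).

    _Power series._  Both identities hold in polynomial rings, whereas the
    functions in the theorem are power series in countably many variables.  A
    series [F] is compared with polynomials in [N] variables through its
    coefficients at the monomials in the first [N] variables ([restricts_to]); this
    respects products, and every monomial involves finitely many variables, so an
    identity valid for all [N] is an identity of series.  Conversely [n] variables
    suffice for the e_lambda with [lambda] a partition of [n] to be independent,
    by the fundamental theorem on symmetric polynomials; hence the expansion is
    unique ([elem_expansion_uniq]) and its coefficients are those of the theorem. *)

(** * Restricting power series to finitely many variables *)

Section Monomials.
Variable N : nat.
Implicit Types (m : 'X_{1..N}) (c : {cmonom nat}).

Definition cmon_of m : {cmonom nat} :=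
  \big[mmul/mone]_(i < N) \big[mmul/mone]_(j < m i) ucm (val i).

Lemma cmon_prodE (I : Type) (r : seq I) (P : pred I) (F : I -> {cmonom nat}) k :
  (\big[mmul/mone]_(i <- r | P i) F i) k = (\sum_(i <- r | P i) F i k)%N.
Proof. exact: (big_morph (fun c : {cmonom nat} => c k) (cmM k) (cm1 k)). Qed.

Lemma cmon_ofE m k : cmon_of m k = (\sum_(i < N | val i == k) m i)%N.
Proof.
rewrite cmon_prodE [RHS]big_mkcond; apply: eq_bigr => i _ /=.
rewrite cmon_prodE.
under eq_bigr do rewrite ucmE.
by rewrite big_const_ord iter_addn_0; case: eqP => _; rewrite ?mul1n ?mul0n.
Qed.

Lemma cmon_of_ord m (i : 'I_N) : cmon_of m i = m i.
Proof. by rewrite cmon_ofE (big_pred1 i). Qed.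

Lemma cmon_of_ge m k : (N <= k)%N -> cmon_of m k = 0%N.
Proof.
move=> Nk; rewrite cmon_ofE big_pred0// => i.
by apply/eqP => ik; move: Nk; rewrite -ik leqNgt ltn_ord.
Qed.

Lemma cmon_of_inj : injective cmon_of.
Proof. by move=> m1 m2 E; apply/mnmP => i; rewrite -!cmon_of_ord E. Qed.

Lemma cmon_ofP c : (forall k, (N <= k)%N -> c k = 0%N) -> exists m, c = cmon_of m.
Proof.
move=> c0; exists [multinom c (val i) | i < N]; apply/eqP/cmP => k.
have [Nk|kN] := leqP N k; first by rewrite c0// cmon_of_ge.
by rewrite -[k]/(val (Ordinal kN)) cmon_of_ord mnmE.
Qed.

Lemma cmon_ofD m1 m2 : cmon_of (m1 + m2)%MM = mmul (cmon_of m1) (cmon_of m2).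
Proof.
apply/eqP/cmP => k; rewrite cmM !cmon_ofE -big_split.
by apply: eq_bigr => i _; rewrite mnmDE.
Qed.

Lemma cmon_of0 : cmon_of 0%MM = mone.
Proof.
apply/eqP/cmP => k; rewrite cm1 cmon_ofE big1// => i _.
by rewrite mnmE.
Qed.

Lemma cmon_ofU (i : 'I_N) : cmon_of U_(i)%MM = ucm (val i).
Proof.
apply/eqP/cmP => k; rewrite ucmE cmon_ofE.
under eq_bigr do rewrite mnmE.
rewrite big_mkcond (bigD1 i)//= big1 ?addn0; first by rewrite eqxx; case: eqP.
by move=> j /negPf ji; rewrite [i == j]eq_sym ji; case: ifP.
Qed.

Lemma cmon_of_prodU (I : Type) (r : seq I) (P : pred I) (F : I -> 'I_N) :
  cmon_of (\sum_(i <- r | P i) U_(F i))%MM =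
  \big[mmul/mone]_(i <- r | P i) ucm (val (F i)).
Proof.
rewrite (big_morph cmon_of cmon_ofD cmon_of0).
by apply: eq_bigr => i _; rewrite cmon_ofU.
Qed.

(** A divisor of a monomial in the first [N] variables involves only these
    variables: the coefficients of a product of series at such monomials depend
    only on the restrictions of the factors. *)
Lemma cmon_of_mmul m c1 c2 : mmul c1 c2 = cmon_of m ->
  exists m1 m2, [/\ c1 = cmon_of m1, c2 = cmon_of m2 & m = (m1 + m2)%MM].
Proof.
move=> E; have c0 k : (N <= k)%N -> (c1 k + c2 k)%N = 0%N.
  by move=> Nk; rewrite -cmM E cmon_of_ge.
have [|m1 E1] := @cmon_ofP c1.
  by move=> k /c0/eqP; rewrite addn_eq0 => /andP[/eqP].
have [|m2 E2] := @cmon_ofP c2.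
  by move=> k /c0/eqP; rewrite addn_eq0 => /andP[_ /eqP].
exists m1, m2; split=> //; apply: cmon_of_inj.
by rewrite -E E1 E2 cmon_ofD.
Qed.

Lemma cmon_of_prod_ucm m (I : eqType) (r : seq I) (F : I -> nat) :
  \big[mmul/mone]_(i <- r) ucm (F i) = cmon_of m ->
  forall i, i \in r -> (F i < N)%N.
Proof.
move=> E i ir; rewrite ltnNge; apply/negP => Ni.
have : cmon_of m (F i) = 0%N by apply: cmon_of_ge.
rewrite -E cmon_prodE => /eqP; rewrite sum_nat_seq_eq0 => /allP/(_ _ ir).
by rewrite ucmE eqxx.
Qed.

End Monomials.

(** The number of variables is a successor so that there is at least one color. *)
Lemma cmon_of_surj (c : {cmonom nat}) : exists N (m : 'X_{1..N.+1}), c = cmon_of m.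
Proof.
exists (\max_(k <- finsupp c) k)%N.
apply: cmon_ofP => k; apply: contraTeq; rewrite -ltnNge ltnS => ck.
have kc : k \in finsupp c by rewrite mem_finsupp.
by rewrite (big_rem _ kc) leq_maxl.
Qed.

Section Restriction.
Variable N : nat.

(** A series need not be a polynomial after the other variables are set to 0, as
    its degree may be unbounded; the relation says that it is, and names the
    polynomial. *)
Definition restricts_to (F : fps) (p : mpoly N int) :=
  forall m : 'X_{1..N}, F (cmon_of m) = p@_m.

Lemma restricts_one : restricts_to fps_one 1.
Proof.
by move=> m; rewrite /fps_one mcoeff1 -(cmon_of0 N) (inj_eq (@cmon_of_inj N)).
Qed.

Lemma restricts_mul F G p q : restricts_to F p -> restricts_to G q ->
  restricts_to (fps_mul F G) (p * q).
Proof.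
move=> Fp Gq m; rewrite mcoeffM /fps_mul.
rewrite (@bigfs _ _ _ _ _ _ _ (index_enum_uniq _)); last by move=> i _; rewrite mem_index_enum.
pose h (k : 'X_{1..N < (mdeg m).+1, (mdeg m).+1}) : {cmonom nat} * {cmonom nat} :=
  (cmon_of k.1, cmon_of k.2).
rewrite (@reindex_fsbig _ _ _ _ _ h [set` (fun k : 'X_{1..N < (mdeg m).+1, (mdeg m).+1} => m == (k.1 + k.2)%MM)]).
  by apply: eq_fsbigr => k _; rewrite Fp Gq.
split.
- by move=> k /= /eqP mk; rewrite -cmon_ofD -mk.
- move=> k1 k2 _ _ [] /cmon_of_inj E1 /cmon_of_inj E2.
  by case: k1 k2 E1 E2 => [a b] [a' b'] /= /val_inj -> /val_inj ->.
- move=> [c1 c2] /= /cmon_of_mmul[m1 [m2 [-> -> E]]].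
  have d1 : (mdeg m1 < (mdeg m).+1)%N by rewrite E mdegD ltnS leq_addr.
  have d2 : (mdeg m2 < (mdeg m).+1)%N by rewrite E mdegD ltnS leq_addl.
  by exists (BMultinom d1, BMultinom d2) => //=; apply/eqP.
Qed.

(** Passing to polynomials turns a formal sum over the infinite set [A] into a
    sum over a finite type [J], which indexes through [h] those members of [A]
    whose monomial involves only the first [N] variables. *)
Lemma restricts_formal_sum (I : choiceType) (A : set I) (f : I -> {cmonom nat})
    (J : finType) (P : pred J) (g : J -> 'X_{1..N}) (h : J -> I) :
    {in P &, injective h} -> (forall j, P j -> A (h j)) ->
    (forall j, P j -> f (h j) = cmon_of (g j)) ->
    (forall i (m : 'X_{1..N}), A i -> f i = cmon_of m -> exists2 j, P j & h j = i) ->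
  restricts_to (formal_sum A f) (\sum_(j | P j) 'X_[g j]).
Proof.
move=> hI hA hf hS m; rewrite /formal_sum raddf_sum /=.
transitivity (\sum_(j | P j && (g j == m)) (1 : int)); last first.
  by rewrite big_mkcondr; apply: eq_bigr => j _; rewrite mcoeffX; case: eqP.
rewrite (@bigfs _ _ _ _ _ _ _ (index_enum_uniq _)); last by move=> i _; rewrite mem_index_enum.
apply: reindex_fsbig; split.
- by move=> j /= /andP[Pj /eqP <-]; split; [exact: hA|exact: hf].
- by move=> j1 j2 /set_mem/andP[P1 _] /set_mem/andP[P2 _]; exact: hI.
- move=> i [Ai fi]; have [j Pj hj] := hS _ _ Ai fi; exists j => //=.
  by apply/andP; split=> //; apply/eqP/cmon_of_inj; rewrite -hf// hj.
Qed.

End Restriction.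

(** * Restrictions of elementary and chromatic symmetric functions *)

Section ElementaryRestriction.
Variable N : nat.

(** The increasing enumeration of [S]; the default value 0 is used only if
    #|S| is not [k]. *)
Definition set_tuple k (S : {set 'I_N}) : k.-tuple nat :=
  insubd (nseq_tuple k 0%N) [seq val i | i <- enum S].

Lemma set_tupleE k (S : {set 'I_N}) : #|S| == k ->
  set_tuple k S = [seq val i | i <- enum S] :> seq nat.
Proof. by move=> Sk; rewrite /set_tuple insubdK// unfold_in size_map -cardE. Qed.

Lemma sorted_val_enum (S : {set 'I_N}) : sorted ltn [seq val i | i <- enum S].
Proof.
rewrite (map_comp val id)/= map_id.
rewrite sorted_map; apply: (subseq_sorted (leT := relpre val ltn)).
- by move=> x y z /=; apply: ltn_trans.
- rewrite {1}/enum_mem; exact: filter_subseq.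
- by rewrite -enumT -sorted_map val_enum_ord iota_ltn_sorted.
Qed.

Lemma mesym1_sum (S : {set 'I_N}) : mesym1 S = (\sum_(i <- enum S) U_(i))%MM.
Proof.
apply/mnmP => j; rewrite mnmE mnm_sumE.
under eq_bigr do rewrite mnmE.
rewrite big_enum/= big_mkcond (bigD1 j)//= big1 ?addn0 ?eqxx.
  by case: (j \in S).
by move=> i /negPf ->; case: ifP.
Qed.

Lemma restricts_elem_sym k : restricts_to (elem_sym k) (mesym N int k).
Proof.
rewrite mesymE; apply: (restricts_formal_sum (h := set_tuple k)) => /=.
- move=> S1 S2 k1 k2 /(congr1 (@tval _ _)); rewrite !set_tupleE// => E.
  by apply/setP => i; rewrite -[LHS]mem_enum -[RHS]mem_enum (inj_map val_inj E).
- by move=> S kS; rewrite set_tupleE// sorted_val_enum.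
- by move=> S kS; rewrite set_tupleE// mesym1_sum cmon_of_prodU big_map.
- move=> j m j_sorted jm; have jN := cmon_of_prod_ucm jm.
  pose S := [set i : 'I_N | val i \in (j : seq nat)]%SET.
  have SE : [seq val i | i <- enum S] = j.
    apply: (irr_sorted_eq ltn_trans ltnn) => // [|x]; first exact: sorted_val_enum.
    apply/mapP/idP => [[i + ->]|xj]; first by rewrite mem_enum inE.
    by exists (Ordinal (jN _ xj)); rewrite // mem_enum inE.
  have kS : #|S| == k by rewrite cardE -(size_map val) SE size_tuple.
  by exists S => //; apply: val_inj; rewrite /= set_tupleE.
Qed.

Definition mesym_part (la : seq nat) : mpoly N int := \prod_(k <- la) mesym N int k.

Lemma restricts_elem_sym_part la :
  restricts_to (elem_sym_part la) (mesym_part la).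
Proof.
rewrite /elem_sym_part /mesym_part; elim: la => [|k la IH].
  by rewrite !big_nil; exact: restricts_one.
by rewrite !big_cons; apply: restricts_mul => //; exact: restricts_elem_sym.
Qed.

Lemma restricts_chromatic (V : finType) (e : rel V) :
  restricts_to (chromatic_sym e)
    (\sum_(kappa : {ffun V -> 'I_N}
        | [forall u, forall v, e u v ==> (kappa u != kappa v)])
      \prod_v 'X_(kappa v)).
Proof.
under eq_bigr do rewrite -(big_morph _ (@mpolyXD N int) (@mpolyX0 N int)).
apply: (restricts_formal_sum (h := fun kappa : {ffun V -> 'I_N} => [ffun v => val (kappa v)])) => /=.
- move=> k1 k2 _ _ /ffunP E; apply/ffunP => v; apply: val_inj.
  by have := E v; rewrite !ffunE.
- move=> kappa /forallP kP u v euv; rewrite !ffunE => /val_inj E.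
  by have /forallP/(_ v) := kP u; rewrite euv E eqxx.
- move=> kappa _; rewrite cmon_of_prodU.
  by apply: eq_bigr => v _; rewrite ffunE.
- move=> kappa m kP E.
  have kN v : (kappa v < N)%N by apply: (cmon_of_prod_ucm E); rewrite mem_index_enum.
  exists [ffun v => Ordinal (kN v)]; last by apply/ffunP => v; rewrite !ffunE.
  apply/forallP => u; apply/forallP => v; apply/implyP => /kP uv.
  by rewrite !ffunE; apply/eqP => /(congr1 val).
Qed.

End ElementaryRestriction.

(** * Uniqueness of the elementary expansion *)

Lemma partn_perm_eq n (la mu : intpartn n) : perm_eq la mu -> la = mu.
Proof.
case: la mu => [s sP] [t tP] /= st; apply: val_inj => /=.
move: sP tP => /and3P[s_sorted _ _] /and3P[t_sorted _ _].
apply: (sorted_eq _ _ s_sorted t_sorted st).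
- by move=> x y z; rewrite /geq /= => yx xz; apply: leq_trans xz yx.
- by move=> x y; rewrite /geq /= andbC -eqn_leq => /eqP.
Qed.

Lemma partn_gt0 n (la : intpartn n) i : i \in (la : seq nat) -> (0 < i)%N.
Proof. by case: la => s /= /and3P[_ s0 _] si; rewrite lt0n; apply: contra s0 => /eqP <-. Qed.

Lemma partn_notin0 n (la : intpartn n) : 0%N \notin (la : seq nat).
Proof. by case: la => s /= /and3P[]. Qed.

Lemma partn_sumn n (la : intpartn n) : sumn la = n.
Proof. by case: la => s /= /and3P[_ _ /eqP]. Qed.

Section Uniqueness.
Variable n : nat.

Definition part_mult (s : seq nat) : 'X_{1..n} :=
  [multinom count_mem i.+1 s | i < n].

(** Substituting e_1, ..., e_n for the variables turns the monomial with
    exponents [part_mult la] into e_la, so linear independence of the e_la is an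
    instance of the algebraic independence of e_1, ..., e_n. *)
Lemma mesym_part_comp (s : seq nat) : {in s, forall k, 0 < k <= n}%N ->
  mesym_part n s = 'X_[part_mult s] \mPo [tuple mesym n int i.+1 | i < n].
Proof.
elim: s => [|k s IH] sP; rewrite /mesym_part.
  by rewrite big_nil (_ : part_mult _ = 0%MM) ?mpolyX0 ?comp_mpoly1//; apply/mnmP => i; rewrite !mnmE.
rewrite big_cons -/(mesym_part n s) IH; last by move=> i si; apply: sP; rewrite inE si orbT.
have /andP[k0 kn] := sP k (mem_head _ _).
case: k k0 kn {sP} => // k _ kn.
rewrite (_ : part_mult (k.+1 :: s) = (U_(Ordinal kn) + part_mult s)%MM); last first.
  by apply/mnmP => i; rewrite mnmDE !mnmE /= eqSS.
by rewrite mpolyXD rmorphM /= comp_mpolyXU -tnth_nth tnth_mktuple.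
Qed.

Lemma part_mult_inj (la mu : intpartn n) : part_mult la = part_mult mu -> la = mu.
Proof.
move=> E; apply: partn_perm_eq; apply/allP => -[|k] _ /=.
  rewrite !(count_memPn _)//; by apply/negP => /partn_gt0.
have [kn|nk] := ltnP k n.
  by have /mnmP/(_ (Ordinal kn)) := E; rewrite !mnmE /= => ->.
by rewrite !(count_memPn _)//; apply/negP => /intpartn_le; rewrite leqNgt ltnS nk.
Qed.

Lemma elem_expansion_uniq (F : fps) (c d : {ffun intpartn n -> int}) :
  elem_expansion F c -> elem_expansion F d -> c = d.
Proof.
move=> Fc Fd; pose t (f : {ffun intpartn n -> int}) : mpoly n int :=
  \sum_la f la *: 'X_[part_mult la].
have tE f (m : 'X_{1..n}) : elem_expansion F f ->
    (t f \mPo [tuple mesym n int i.+1 | i < n])@_m = F (cmon_of m).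
  move=> Ff; rewrite Ff /t.
  rewrite (big_morph _ (comp_mpolyD _) (comp_mpoly0 _)) [LHS]raddf_sum.
  apply: eq_bigr => la _ /=.
  rewrite comp_mpolyZ mcoeffZ -mesym_part_comp ?restricts_elem_sym_part//.
  by move=> k kla; rewrite (partn_gt0 kla) (intpartn_le kla).
have coefE f (la : intpartn n) : (t f)@_(part_mult la) = f la.
  rewrite /t raddf_sum (bigD1 la)//= mcoeffZ mcoeffX eqxx mulr1 big1 ?addr0// => mu.
  move=> /negPf mula; rewrite mcoeffZ mcoeffX; case: eqP => [/part_mult_inj E|_].
    by rewrite E eqxx in mula.
  by rewrite mulr0.
apply/ffunP => la; rewrite -!coefE; congr mcoeff.
by apply: msym_fundamental_un; apply/mpolyP => m; rewrite !tE.
Qed.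

End Uniqueness.

(** * Newton's identities *)

Section Newton.
Variables (R : comNzRingType) (I : finType) (x : I -> R).

Definition esum k : R := \sum_(h : {set I} | #|h| == k) \prod_(i in h) x i.
Definition psum k : R := \sum_i x i ^+ k.

(** For j >= 2 this is the monomial symmetric function of the hook (j, 1^a). *)
Definition hook a j : R :=
  \sum_(h : {set I} | #|h| == a) \sum_(i | i \notin h) x i ^+ j * \prod_(k in h) x k.

(** The terms of e_a p_j in which [x i] already occurs in the squarefree factor;
    taking it out of there raises its exponent, see [hook_inS]. *)
Definition hook_in a j : R :=
  \sum_(h : {set I} | #|h| == a) \sum_(i in h) x i ^+ j * \prod_(k in h) x k.

Lemma esum0 : esum 0 = 1.
Proof.
rewrite /esum (big_pred1 set0) ?big_set0// => h; by rewrite cards_eq0.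
Qed.

Lemma esum_psum a j : esum a * psum j = hook a j + hook_in a j.
Proof.
rewrite /esum mulr_suml -big_split; apply: eq_bigr => h _ /=.
rewrite /psum mulr_sumr (bigID (mem h)) /= addrC.
by congr (_ + _); apply: eq_bigr => i _; rewrite mulrC.
Qed.

Lemma hook_in0 j : hook_in 0 j = 0.
Proof.
rewrite /hook_in big1// => h; rewrite cards_eq0 => /eqP ->.
by rewrite !big_set0.
Qed.

Lemma hook_inS a j : hook_in a.+1 j = hook a j.+1.
Proof.
rewrite /hook_in /hook (exchange_big_dep xpredT)//= [RHS](exchange_big_dep xpredT)//=.
apply: eq_bigr => i _.
rewrite (reindex_onto (fun h : {set I} => i |: h)%SET (fun h : {set I} => h :\ i)%SET) /=; last first.
  by move=> h /andP[_ ih]; rewrite setD1K.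
apply: eq_big => [h|h /andP[/andP[_ _] /eqP hi]].
  rewrite setU11 andbT; apply/andP/andP => [[ha /eqP hi]|[ha ih]].
    have ih : i \notin h by rewrite -hi setD11.
    by move: ha; rewrite cardsU1 ih add1n eqSS.
  by rewrite cardsU1 ih add1n eqSS ha setU1K.
have ih : i \notin h by rewrite -hi setD11.
by rewrite big_setU1//= mulrA exprSr.
Qed.

Lemma hook_in_count a : hook_in a 0 = a%:R * esum a.
Proof.
rewrite /hook_in /esum mulr_sumr; apply: eq_bigr => h /eqP <-.
by under [LHS]eq_bigr do rewrite expr0 mul1r; rewrite sumr_const mulr_natl.
Qed.

(** By [esum_psum] and [hook_inS], e_a p_j = hook a j + hook (a - 1) (j + 1); this
    is the telescoping alternating sum of these relations. *)
Lemma hook_alt a j :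
  hook a j = \sum_(i < a.+1) (-1) ^+ i * esum (a - i)%N * psum (j + i)%N.
Proof.
elim: a j => [|a IH] j.
  by rewrite big_ord1 mul1r addn0 esum_psum hook_in0 addr0.
rewrite big_ord_recl /= expr0 mul1r subn0 addn0 esum_psum hook_inS. rewrite IH /bump /=.
rewrite -addrA -big_split /= big1 ?addr0// => i _.
by rewrite subSS addSnnS exprS !mulN1r !mulNr subrr.
Qed.

(** The case j = 1 of [hook_alt], whose left-hand side is (k + 1) e_(k+1) by
    [hook_in_count], solved for the last power sum. *)
Lemma newton k : psum k.+1 =
  (-1) ^+ k * k.+1%:R * esum k.+1 +
  \sum_(j < k) (-1) ^+ j * esum j.+1 * psum (k - j)%N.
Proof.
rewrite -mulrA -hook_in_count hook_inS hook_alt big_ord_recr /= subnn esum0.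
rewrite mulr1 mulrDr mulrA -expr2 sqrr_sign mul1r add1n addrC addrA.
rewrite mulr_sumr [X in X + _](_ : _ = 0) ?add0r//.
rewrite [X in X + _](reindex_inj rev_ord_inj) /= -big_split big1// => i _ /=.
have ik := ltn_ord i.
rewrite subnSK// subKn// add1n !mulrA -exprD -mulrDl -mulrDl.
have -> : (k + i = (k - i.+1) + (i.+1 + i))%N by rewrite addnA subnK.
by rewrite addSn exprD exprS exprD -expr2 sqrr_sign mulr1 mulrN1 subrr !mul0r.
Qed.

End Newton.

(** * Compositions and brick tabloids *)

(** The compositions of k + 1, provided k <= f: the recursion follows [newton], and
    [f] only bounds its depth.  Composing a positive number, rather than [k]
    itself, leaves no empty composition, which would have no last brick. *)
Fixpoint comps f k : seq (seq nat) :=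
  [:: k.+1] ::
  if f is f'.+1 then
    [seq j.+1 :: a | j <- iota 0 k, a <- comps f' (k - j.+1)%N]
  else [::].

Lemma nil_notin_comps f k : [::] \notin comps f k.
Proof.
case: f => [|f]; rewrite [comps _ _]/= inE //.
by apply/allpairsPdep => -[j [c [_ _]]].
Qed.

Lemma mem_comps f k a : (k <= f)%N ->
  (a \in comps f k) = (0%N \notin a) && (sumn a == k.+1).
Proof.
elim: f k a => [|f IH] k a.
  rewrite leqn0 => /eqP -> /=; rewrite inE.
  case: a => [|i [|j b]] //=; first by rewrite eqseq_cons andbT inE addn0; case: i => [|[]].
  rewrite eqseq_cons andbF !inE; case: i => [|i] //; case: j => [|j]; first by rewrite orbT.
  by rewrite !addSn addnS !eqSS andbF.
move=> kf; rewrite [comps _ _]/= inE.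
case: a => [|i b]; first by apply/allpairsPdep => -[j [c [_ _]]].
rewrite eqseq_cons; have [->|b0] := eqVneq b [::].
  rewrite andbT /= addn0 inE.
  have -> : [:: i] \in [seq j.+1 :: a | j <- iota 0 k, a <- comps f (k - j.+1)%N] = false.
    apply/allpairsPdep => -[j [c [_ + [_ cE]]]].
    by rewrite -cE (negPf (nil_notin_comps _ _)).
  by rewrite orbF; case: eqP => [->|]; rewrite ?andbF.
rewrite andbF orFb /= inE.
apply/allpairsPdep/andP => [[j [c [+ + [-> ->]]]]|[]].
  rewrite mem_iota add0n => /= jk.
  rewrite IH; last by rewrite leq_subLR addSn (leq_trans kf)// ltnS leq_addl.
  move=> /andP[c0 /eqP cs]; split=> //.
  by rewrite cs subnSK// addSn subnKC// ltnW.
case: i => [|j]; first by rewrite eqxx.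
move=> /= bP; rewrite addSn eqSS => /eqP E.
have bs : (0 < sumn b)%N.
  case: b b0 bP {E} => // i b _; rewrite inE negb_or => /andP[i0 _] /=.
  by rewrite addn_gt0 lt0n eq_sym i0.
have jk : (j < k)%N by rewrite -E -[X in (X < _)%N]addn0 ltn_add2l.
exists j, b; split => //; first by rewrite mem_iota.
rewrite IH; last by rewrite leq_subLR addSn (leq_trans kf)// ltnS leq_addl.
by rewrite bP subnSK// -E addKn eqxx.
Qed.

Lemma comps_uniq f k : uniq (comps f k).
Proof.
elim: f k => [|f IH] k //=; apply/andP; split.
  apply/allpairsPdep => -[j [c [+ + [jk cE]]]].
  by rewrite -cE (negPf (nil_notin_comps _ _)).
apply: allpairs_uniq_dep; first exact: iota_uniq.
  by move=> j _; apply: IH.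
by move=> [j a] [j' a'] _ _ /= [-> ->].
Qed.

(** A sum indexed by objects of type [s i] is grouped by the integer partition that
    rearranges [s i]; it is used for connected partitions and for tabloids. *)
Lemma sum_by_partn n (R : nmodType) (I : eqType) (r : seq I) (P : pred I)
    (s : I -> seq nat) (F : I -> R) :
    (forall i, i \in r -> P i -> 0%N \notin s i /\ sumn (s i) = n) ->
  \sum_(i <- r | P i) F i =
  \sum_(la : intpartn n) \sum_(i <- r | P i && perm_eq (s i) la) F i.
Proof.
move=> sP; rewrite [RHS](exchange_big_dep P)/=; last by move=> la i _ /andP[].
rewrite [LHS]big_seq_cond [RHS]big_seq_cond; apply: eq_bigr => i /andP[ir Pi].
have [s0 sn] := sP i ir Pi.
have laP : is_partn n (sort geq (s i)).
  apply/and3P; split; last by rewrite (perm_sumn (permEl (perm_sort _ _))) sn.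
    by apply: sort_sorted => x y; exact: leq_total.
  by rewrite mem_sort.
rewrite (big_pred1 (IntPartn laP))// => la /=; rewrite Pi /=.
apply/idP/eqP => [sla|->]; last by rewrite /= perm_sym perm_sort.
by apply: partn_perm_eq; rewrite perm_sym /= perm_sort.
Qed.

Section Tabloids.

Definition compositions k := comps k.-1 k.-1.

Definition tabloids (mu : seq nat) : seq (seq (seq nat)) :=
  foldr (fun k ts => [seq r :: t | r <- compositions k, t <- ts]) [:: [::]] mu.

Lemma mem_compositions k a : (0 < k)%N ->
  (a \in compositions k) = (0%N \notin a) && (sumn a == k).
Proof. by case: k => // k _; rewrite mem_comps. Qed.

Lemma mem_tabloids mu t : 0%N \notin mu ->
  (t \in tabloids mu) = (map sumn t == mu) && (0%N \notin flatten t).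
Proof.
elim: mu t => [|k mu IH] t /=; first by rewrite inE; case: t.
rewrite inE negb_or eq_sym -lt0n => /andP[k0 mu0].
apply/allpairsP/idP => [[[r u] [/=]]|].
  rewrite mem_compositions// IH// => /andP[r0 /eqP rk] /andP[/eqP um u0] ->.
  by rewrite /= rk um eqxx mem_cat negb_or r0.
case: t => [|r u] //=; rewrite eqseq_cons mem_cat negb_or.
move=> /andP[/andP[rk um] /andP[r0 u0]].
by exists (r, u); rewrite mem_compositions// IH// r0 rk um.
Qed.

Lemma tabloids_uniq mu : uniq (tabloids mu).
Proof.
elim: mu => [|k mu IH] //=; apply: allpairs_uniq => //; first exact: comps_uniq.
by move=> [r t] [r' t'] _ _ /= [-> ->].
Qed.

Lemma total_brick_weightE la mu : 0%N \notin la -> 0%N \notin mu ->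
  total_brick_weight la mu =
  \sum_(t <- tabloids mu | perm_eq (flatten t) la) (brick_weight t)%:Z.
Proof.
move=> la0 mu0; rewrite /total_brick_weight -[RHS]big_filter.
rewrite [RHS]fsbig_seq ?filter_uniq ?tabloids_uniq//; apply: eq_fsbigl.
apply/seteqP; split => t /=; rewrite mem_filter mem_tabloids// /brick_tabloids/= /splits.
  by move=> /andP[-> tla]; rewrite tla (perm_mem tla).
by move=> /and3P[-> -> _].
Qed.

End Tabloids.

(** * Power sums in terms of elementary functions *)

Section PowerSums.
Variables (R : comNzRingType) (I : finType) (x : I -> R).

(** Each step of the recursion is one use of [newton]: the composition with the
    single part k + 1 is the term (k + 1) e_(k+1), and a first part j + 1 is the factor
    e_(j+1) of the other terms, which leaves the last part unchanged. *)
Lemma comps_sum f k : (k <= f)%N ->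
  \sum_(a <- comps f k) (-1) ^+ (k.+1 + size a) *
    (last 0%N a)%:R * \prod_(i <- a) esum x i =
  psum x k.+1.
Proof.
elim: f k => [|f IH] k kf; rewrite [comps _ _]/= big_cons big_seq1 /= addn1 2!exprS !mulN1r opprK newton.
  by move: kf; rewrite leqn0 => /eqP ->; rewrite big_nil big_ord0.
congr (_ + _); rewrite big_allpairs_dep -[X in iota _ X]subn0 -/(index_iota 0 k) big_mkord.
apply: eq_bigr => j _; have jk := ltn_ord j.
rewrite -(subnSK jk) -IH; last by rewrite leq_subLR addSn (leq_trans kf)// ltnS leq_addl.
rewrite mulr_sumr big_seq [RHS]big_seq; apply: eq_bigr => a acomp.
have -> : last 0%N (j.+1 :: a) = last 0%N a.
  by case: a acomp => //; rewrite (negPf (nil_notin_comps _ _)).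
rewrite big_cons /= !mulrA; congr (_ * _); rewrite -!mulrA [esum _ _ * _]mulrC !mulrA.
congr (_ * _ * _). rewrite -exprD (subnSK jk).
have -> : (k.+1 + (size a).+1 = (j + (k - j + size a)).+2)%N.
  by rewrite addnS addSn addnA subnKC// ltnW.
by rewrite 2!exprS !mulN1r opprK.
Qed.

Lemma compositions_sum k : (0 < k)%N ->
  psum x k = \sum_(a <- compositions k)
    (-1) ^+ (k + size a) * (last 0%N a)%:R * \prod_(i <- a) esum x i.
Proof. by case: k => // k _; rewrite comps_sum. Qed.

Lemma tabloids_sum mu : 0%N \notin mu ->
  \prod_(k <- mu) psum x k = \sum_(t <- tabloids mu)
    (-1) ^+ (sumn mu + size (flatten t)) * (brick_weight t)%:R * \prod_(i <- flatten t) esum x i.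
Proof.
elim: mu => [|k mu IH] /=; first by rewrite big_nil big_seq1 /= /brick_weight !big_nil !mulr1.
rewrite inE negb_or eq_sym -lt0n => /andP[k0 mu0].
rewrite big_cons IH// compositions_sum// mulr_suml big_allpairs_dep.
apply: eq_bigr => a _; rewrite mulr_sumr; apply: eq_bigr => t _ /=.
rewrite /brick_weight big_cons big_cat natrM size_cat /=.
by rewrite addnACA [in RHS]exprD mulrACA [X in X * _ = _]mulrACA.
Qed.

Lemma psum_esum n (mu : intpartn n) :
  \prod_(k <- mu) psum x k = \sum_(la : intpartn n)
    (-1) ^+ (n + size la) * (total_brick_weight la mu)%:~R * \prod_(k <- la) esum x k.
Proof.
have mu0 := partn_notin0 mu; have mun := partn_sumn mu.
rewrite tabloids_sum// (sum_by_partn (n := n) (s := @flatten nat)); last first.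
  move=> t; rewrite mem_tabloids// => /andP[/eqP tmu t0] _; split => //.
  by rewrite sumn_flatten tmu.
apply: eq_bigr => la _.
rewrite total_brick_weightE ?partn_notin0// rmorph_sum /=.
rewrite mulr_sumr mulr_suml; apply: eq_bigr => t tla.
by rewrite mun (perm_size tla) (perm_big _ tla).
Qed.

End PowerSums.

(** * The two sides of an edge of a tree *)

Section Sides.
Variables (V : finType) (e : rel V).
Hypothesis e_sym : ssrbool.symmetric e.
Variables u v : V.
Hypothesis euv : e u v.

Definition cut_edge : rel V :=
  [rel x y | e x y && ~~ ((x == u) && (y == v) || (x == v) && (y == u))].

Definition induced (B : {set V}) : rel V :=
  [rel x y | [&& x \in B, y \in B & e x y]].

(** For w = u and w = v, the two components left when the edge [uv] is removed. *)
Definition side w : {set V} := [set x | connect cut_edge w x]%SET.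

Lemma induced_sym B : ssrbool.symmetric (induced B).
Proof. by move=> x y; rewrite /induced /= e_sym andbCA. Qed.

Lemma cut_edge_sym : ssrbool.symmetric cut_edge.
Proof. by move=> x y; rewrite /cut_edge /= e_sym [in RHS]orbC ![(y == _) && _]andbC. Qed.

Lemma side_refl w : w \in side w.
Proof. by rewrite inE connect0. Qed.

Lemma side_step w x y : x \in side w -> cut_edge x y -> y \in side w.
Proof. by rewrite !inE => wx xy; apply: connect_trans wx (connect1 xy). Qed.

Lemma connect_ind_r (r : rel V) (Q : V -> Prop) a :
    Q a -> (forall x y, Q x -> r x y -> Q y) -> forall x, connect r a x -> Q x.
Proof.
move=> Qa Qr x /connectP[p pP ->]; elim: p a Qa pP => //= y p IH a Qa /andP[ay].
by apply: IH; apply: Qr Qa ay.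
Qed.

Lemma edge_cut x y : e x y ->
  [\/ cut_edge x y, x = u /\ y = v | x = v /\ y = u].
Proof.
move=> exy; have [xy|] := boolP (cut_edge x y); first exact: Or31.
rewrite /cut_edge /= exy /= negbK => /orP[/andP[/eqP-> /eqP->]|/andP[/eqP-> /eqP->]].
  exact: Or32.
exact: Or33.
Qed.

Lemma side_cover x : (forall y, connect e u y) -> (x \in side u) || (x \in side v).
Proof.
move=> uP.
apply: (connect_ind_r (Q := fun x => (x \in side u) || (x \in side v)) _ _ (uP x)).
  by rewrite side_refl.
move=> {}x y xS /edge_cut[xy|[_ ->]|[_ ->]]; rewrite ?side_refl ?orbT//.
by case/orP: xS => /side_step/(_ xy) ->; rewrite ?orbT.
Qed.

(** A simple path from [u] to [v] avoiding the edge [uv] would close up with it to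
    a cycle. *)
Lemma cut_edge_separates : irreflexive e ->
  (forall c : seq V, (2 < size c)%N -> ~ ucycle e c) -> v \notin side u.
Proof.
move=> e_irr acyc; apply/negP; rewrite inE => /connectP[p0 p0P p0v].
case: (shortenP p0P) p0v => p pP p_uniq _ pv.
apply: (acyc (u :: p)).
  case: p pP p_uniq pv => [|a [|b p]] //=; first by move=> _ _ vu; move: euv; rewrite vu e_irr.
  by move=> /andP[/andP[_ +] _] _ va; rewrite -va !eqxx.
apply/andP; split => //=; rewrite rcons_path -pv e_sym euv andbT.
by apply: sub_path pP => x y /andP[].
Qed.

Lemma induces_connected_from (B : {set V}) c :
  (forall x, x \in B -> connect (induced B) c x) -> induces_connected e B.
Proof.
move=> cB; apply/forall_inP => x xB; apply/forall_inP => y yB.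
apply: connect_trans (cB y yB).
by rewrite (sym_connect_sym (@induced_sym B)); apply: cB.
Qed.

(** A connected set that misses [v] contains no copy of the edge [uv], so it stays on
    the side of [u]: merging two blocks can be undone by cutting. *)
Lemma side_sub (B : {set V}) : induces_connected e B -> u \in B -> v \notin B ->
  B \subset side u.
Proof.
move=> /forall_inP Bc uB vB; apply/subsetP => x xB.
have /forall_inP/(_ x xB) ux := Bc u uB.
apply: (connect_ind_r (Q := fun x => x \in side u) _ _ ux); first exact: side_refl.
move=> y z yS /and3P[yB zB eyz]; apply: side_step yS _.
case: (edge_cut eyz) => // -[yE zE]; last by rewrite yE (negPf vB) in yB.
by rewrite zE (negPf vB) in zB.
Qed.

Lemma connected_merge (B C : {set V}) : induces_connected e B ->
  induces_connected e C -> u \in B -> v \in C -> induces_connected e (B :|: C)%SET.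
Proof.
move=> /forall_inP Bc /forall_inP Cc uB vC.
have sub (D : {set V}) x y : D \subset (B :|: C)%SET -> connect (induced D) x y ->
    connect (induced (B :|: C)%SET) x y.
  move=> /subsetP DS; apply: connect_sub => a b /and3P[aD bD ab].
  by apply: connect1; apply/and3P; split=> //; apply: DS.
apply: (induces_connected_from (c := u)) => x; rewrite inE => /orP[xB|xC].
  by apply: (sub B); rewrite ?subsetUl//; have /forall_inP/(_ x xB) := Bc u uB.
apply: (connect_trans (y := v)).
  by apply: connect1; apply/and3P; split=> //; rewrite inE ?uB ?vC ?orbT.
by apply: (sub C); rewrite ?subsetUr//; have /forall_inP/(_ x xC) := Cc v vC.
Qed.

(** A path inside [B] can return to the side of [u] from the other side only through
    [u] itself, so the points of [B] on this side are reached from [u] without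
    leaving it. *)
Lemma connected_split (B : {set V}) : v \notin side u ->
  induces_connected e B -> u \in B -> induces_connected e (B :&: side u)%SET.
Proof.
move=> vS /forall_inP Bc uB.
apply: (induces_connected_from (c := u)) => x; rewrite inE => /andP[xB xS].
have /forall_inP/(_ x xB) ux := Bc u uB.
apply: (connect_ind_r (Q := fun x => x \in side u ->
   connect (induced (B :&: side u)%SET) u x) _ _ ux xS); first by rewrite connect0.
move=> y z IH /and3P[yB zB eyz] zS.
case: (edge_cut eyz) => [yz|[_ zE]|[_ ->]]; last by rewrite connect0.
  have yS : y \in side u by apply: side_step zS _; rewrite cut_edge_sym.
  apply: connect_trans (IH yS) (connect1 _).
  by apply/and3P; split=> //; rewrite inE ?yB ?zB.
by rewrite zE (negPf vS) in zS.
Qed.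

End Sides.

(** * Connected partitions with monochromatic blocks *)

Section Toggle.
Variables (V : finType) (e : rel V).
Hypothesis e_sym : ssrbool.symmetric e.
Hypothesis e_irr : irreflexive e.
Hypothesis e_conn : forall x y, connect e x y.
Hypothesis e_acyc : forall c : seq V, (2 < size c)%N -> ~ ucycle e c.
Variables (C : eqType) (kappa : V -> C).

Definition constant_blocks (P : {set {set V}}) : bool :=
  [forall B in P, forall x in B, forall y in B, kappa x == kappa y].

Definition mono_partition (P : {set {set V}}) : bool :=
  connected_partition e P && constant_blocks P.

Lemma mono_partitionP (P : {set {set V}}) :
  reflect (finset.partition P [set: V]%SET /\ forall B, B \in P ->
    induces_connected e B /\ {in B &, forall x y, kappa x = kappa y})
    (mono_partition P).
Proof.
apply: (iffP andP) => [[/andP[Pp /forall_inP Pc] /forall_inP Pk]|[Pp PB]].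
  split=> // B BP; split=> [|x y xB yB]; first exact: Pc.
  by have /forall_inP/(_ x xB)/forall_inP/(_ y yB)/eqP := Pk B BP.
split; first by rewrite /connected_partition Pp; apply/forall_inP => B /PB[].
apply/forall_inP => B /PB[_ Bk]; apply/forall_inP => x xB; apply/forall_inP => y yB.
by apply/eqP; apply: Bk.
Qed.

Section Edge.
Variables u v : V.
Hypothesis euv : e u v.
Hypothesis kuv : kappa u = kappa v.

Let Su := side e u v u.
Let Sv := side e u v v.

(** Exchanging [u] and [v] keeps the sides, so the lemmas about the side of [u] apply
    to that of [v]. *)
Lemma side_swap w : side e v u w = side e u v w.
Proof.
apply/setP => x; rewrite !inE; apply: eq_connect => a b.
by rewrite /cut_edge /= [in LHS]orbC.
Qed.

Lemma side_disjoint x : x \in Su -> x \in Sv -> False.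
Proof.
rewrite !inE => ux vx; have := cut_edge_separates e_sym euv e_irr e_acyc.
rewrite inE; case/negP; apply: connect_trans ux _.
by rewrite (sym_connect_sym (cut_edge_sym e_sym u v)).
Qed.

Lemma v_notin_Su : v \notin Su.
Proof. exact: (cut_edge_separates e_sym euv e_irr e_acyc). Qed.

Lemma u_notin_Sv : u \notin Sv.
Proof. by apply/negP => /(side_disjoint (side_refl _ _ _ _)). Qed.

Lemma side_split (B : {set V}) : (B :&: Su :|: B :&: Sv = B)%SET.
Proof.
rewrite -setIUr; apply/setIidPl/subsetP => x _; rewrite inE.
by apply: side_cover.
Qed.

Definition split_block P (B : {set V}) : {set {set V}} :=
  ((B :&: Su) |: ((B :&: Sv) |: P :\ B))%SET.

Definition merge_blocks P (B D : {set V}) : {set {set V}} :=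
  ((B :|: D) |: (P :\ B :\ D))%SET.

Lemma notin_setD1 (P : {set {set V}}) (B D : {set V}) x :
  finset.partition P [set: V]%SET -> B \in P -> x \in B -> x \in D -> D \notin (P :\ B)%SET.
Proof.
move=> /and3P[_ tI _] BP xB xD; rewrite !inE; apply/negP => /andP[DB DP].
by rewrite -(def_pblock tI DP xD) (def_pblock tI BP xB) eqxx in DB.
Qed.

Lemma partition_split (P : {set {set V}}) (B : {set V}) :
    finset.partition P [set: V]%SET -> B \in P -> u \in B -> v \in B ->
  finset.partition (split_block P B) [set: V]%SET.
Proof.
move=> Pp BP uB vB; have P1 := partitionD1 Pp BP.
have dis : [disjoint B :&: Sv & [set: V] :\: B]%SET.
  by rewrite disjoint_subset; apply/subsetP => x; rewrite !inE => /andP[-> _].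
have Bv0 : (B :&: Sv)%SET != finset.set0.
  by apply/set0Pn; exists v; rewrite inE vB side_refl.
have Bu0 : (B :&: Su)%SET != finset.set0.
  by apply/set0Pn; exists u; rewrite inE uB side_refl.
have P2 := partitionU1 P1 Bv0 dis.
have dis' : [disjoint B :&: Su & B :&: Sv :|: [set: V] :\: B]%SET.
  rewrite disjoint_subset; apply/subsetP => x; rewrite !(inE, negb_or, negb_and).
  move=> /andP[-> xu] /=; rewrite andbT; apply/negP => xv.
  by apply: (side_disjoint (x := x)); rewrite inE.
have := partitionU1 P2 Bu0 dis'.
by rewrite [X in finset.partition _ X]finset.setUA side_split finset.setTD finset.setUCr.
Qed.

Lemma mono_split (P : {set {set V}}) (B : {set V}) :
    mono_partition P -> B \in P -> u \in B -> v \in B ->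
  mono_partition (split_block P B).
Proof.
move=> /mono_partitionP[Pp PB] BP uB vB; have [Bc Bk] := PB B BP.
apply/mono_partitionP; split; first exact: partition_split.
move=> D; rewrite !inE => /or3P[/eqP->|/eqP->|/andP[_ /PB]//].
  split; first exact: (connected_split e_sym v_notin_Su).
  by move=> x y; rewrite !inE => /andP[xB _] /andP[yB _]; apply: Bk.
split; last by move=> x y; rewrite !inE => /andP[xB _] /andP[yB _]; apply: Bk.
rewrite /Sv -side_swap; apply: (connected_split e_sym) => //.
by rewrite side_swap u_notin_Sv.
Qed.

Lemma card_split (P : {set {set V}}) (B : {set V}) :
    finset.partition P [set: V]%SET -> B \in P -> u \in B -> v \in B ->
  #|split_block P B| = #|P|.+1.
Proof.
move=> Pp BP uB vB; rewrite /split_block !cardsU1.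
have vSv : v \in (B :&: Sv)%SET by rewrite inE vB side_refl.
have uSu : u \in (B :&: Su)%SET by rewrite inE uB side_refl.
rewrite (notin_setD1 Pp BP vB vSv) !in_setU1 negb_or (notin_setD1 Pp BP uB uSu) andbT.
rewrite (_ : _ != _) ?(cardsD1 B P) ?BP//.
by apply/eqP => E; move: uSu; rewrite E inE (negPf u_notin_Sv) andbF.
Qed.

Lemma partition_merge (P : {set {set V}}) (B D : {set V}) :
    finset.partition P [set: V]%SET -> B \in P -> D \in P -> B != D ->
  finset.partition (merge_blocks P B D) [set: V]%SET.
Proof.
move=> Pp BP DP BD; have P1 := partitionD1 Pp BP.
have DP1 : D \in (P :\ B)%SET by rewrite !inE eq_sym BD.
have P2 := partitionD1 P1 DP1.
have BD0 : (B :|: D)%SET != finset.set0.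
  have /and3P[_ _ P0] := Pp.
  have /set0Pn[x xB] : B != finset.set0 by apply: contraNneq P0 => <-.
  by apply/set0Pn; exists x; rewrite inE xB.
have dis : [disjoint B :|: D & [set: V] :\: B :\: D]%SET.
  by rewrite disjoint_subset; apply/subsetP => x; rewrite !inE => /orP[] ->; rewrite ?andbF.
have := partitionU1 P2 BD0 dis.
by rewrite [X in finset.partition _ (_ :|: X)]finset.setDDl finset.setTD finset.setUCr.
Qed.

Lemma mono_merge (P : {set {set V}}) (B D : {set V}) :
    mono_partition P -> B \in P -> D \in P -> B != D -> u \in B -> v \in D ->
  mono_partition (merge_blocks P B D).
Proof.
move=> /mono_partitionP[Pp PB] BP DP BD uB vD; have [Bc Bk] := PB B BP.
have [Dc Dk] := PB D DP.
apply/mono_partitionP; split; first exact: partition_merge.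
move=> E; rewrite !inE => /orP[/eqP->|/and3P[_ _ /PB]//].
split; first exact: (connected_merge e_sym euv).
have ku x : x \in (B :|: D)%SET -> kappa x = kappa u.
  by rewrite inE => /orP[xB|xD]; [exact: Bk|rewrite kuv; exact: Dk].
by move=> x y /ku -> /ku ->.
Qed.

(** Adds the edge [uv] to, or removes it from, the forest of the edges that lie
    inside blocks of [P]. *)
Definition toggle (P : {set {set V}}) : {set {set V}} :=
  let B := pblock P u in
  if v \in B then split_block P B else merge_blocks P B (pblock P v).

Lemma toggleP (P : {set {set V}}) : mono_partition P ->
  [/\ mono_partition (toggle P), toggle (toggle P) = P &
      odd #|toggle P| = ~~ odd #|P|].
Proof.
move=> Pm; have [Pp PB] := mono_partitionP _ Pm; have /and3P[/eqP Pcov PtI P0] := Pp.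
have bP x : pblock P x \in P by rewrite pblock_mem// Pcov inE.
have xb x : x \in pblock P x by rewrite mem_pblock Pcov inE.
case vB: (v \in pblock P u).
  have -> : toggle P = split_block P (pblock P u) by rewrite /toggle vB.
  have T1 := mono_split Pm (bP u) (xb u) vB.
  have T2 := card_split Pp (bP u) (xb u) vB.
  rewrite T2 T1; split=> //.
  have [T3 _] := mono_partitionP _ T1; have /and3P[_ TtI _] := T3.
  have Bu : pblock (split_block P (pblock P u)) u = (pblock P u :&: Su)%SET.
    apply: def_pblock => //; last by rewrite inE xb side_refl.
    by rewrite !inE eqxx.
  have Bv : pblock (split_block P (pblock P u)) v = (pblock P u :&: Sv)%SET.
    apply: def_pblock => //; last by rewrite inE vB side_refl.
    by rewrite !inE eqxx orbT.
  rewrite /toggle Bu Bv inE (negPf v_notin_Su) andbF /merge_blocks side_split.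
  have uS : u \in (pblock P u :&: Su)%SET by rewrite inE xb side_refl.
  have vS : v \in (pblock P u :&: Sv)%SET by rewrite inE vB side_refl.
  rewrite finset.setU1K; last first.
    rewrite !inE negb_or -in_setD1 (notin_setD1 Pp (bP u) (xb u) uS) andbT.
    by apply/eqP => E; move: uS; rewrite E inE (negPf u_notin_Sv) andbF.
  by rewrite finset.setU1K ?finset.setD1K// (notin_setD1 Pp (bP u) vB vS).
have -> : toggle P = merge_blocks P (pblock P u) (pblock P v) by rewrite /toggle vB.
have BD : pblock P u != pblock P v by apply/eqP => E; rewrite E xb in vB.
have T1 := mono_merge Pm (bP u) (bP v) BD (xb u) (xb v).
have uBv : u \notin pblock P v.
  by apply/negP => uBv; rewrite (same_pblock PtI uBv) eqxx in BD.
have notin : (pblock P u :|: pblock P v)%SET \notin (P :\ pblock P u :\ pblock P v)%SET.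
  rewrite in_setD1 negb_and (notin_setD1 Pp (bP u) (xb u)) ?orbT//.
  by rewrite inE xb.
have [T3 _] := mono_partitionP _ T1; have /and3P[_ TtI _] := T3.
have card : #|P| = #|merge_blocks P (pblock P u) (pblock P v)|.+1.
  rewrite /merge_blocks cardsU1 notin (cardsD1 (pblock P u)) bP.
  by rewrite (cardsD1 (pblock P v)) in_setD1 eq_sym BD bP.
rewrite T1 card /= negbK; split=> //.
have Bu : pblock (merge_blocks P (pblock P u) (pblock P v)) u = (pblock P u :|: pblock P v)%SET.
  apply: def_pblock => //; last by rewrite inE xb.
  by rewrite !inE eqxx.
rewrite /toggle Bu inE xb orbT /split_block /merge_blocks finset.setU1K//.
have /subsetP Bsub : pblock P u \subset Su.
  by apply: side_sub; [have [] := PB _ (bP u)|rewrite xb|rewrite vB].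
have /subsetP Dsub : pblock P v \subset Sv.
  by rewrite /Sv -side_swap; apply: side_sub; [have [] := PB _ (bP v)|rewrite xb|].
have -> : ((pblock P u :|: pblock P v) :&: Su = pblock P u)%SET.
  apply/setP => x; rewrite in_setI in_setU; apply/andP/idP => [[/orP[//|xv] xu]|xu].
    by case: (side_disjoint xu (Dsub _ xv)).
  by rewrite xu Bsub.
have -> : ((pblock P u :|: pblock P v) :&: Sv = pblock P v)%SET.
  apply/setP => x; rewrite in_setI in_setU; apply/andP/idP => [[/orP[xu|//] xv]|xv].
    by case: (side_disjoint (Bsub _ xu) xv).
  by rewrite xv orbT Dsub.
by rewrite finset.setD1K ?finset.setD1K// in_setD1 eq_sym BD bP.
Qed.

Lemma mono_sum_eq0 : \sum_(P | mono_partition P) (-1) ^+ (#|V| + #|P|) = 0 :> int.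
Proof.
set S := \sum_(P | _) _.
have SN : S = - S.
  rewrite {1}/S (reindex_onto toggle toggle) /=; last by move=> P /toggleP[].
  rewrite -sumrN; apply: eq_big => P.
    apply/andP/idP => [[TP /eqP TT]|/toggleP[-> ->]//].
    by have [] := toggleP TP; rewrite TT.
  move=> /andP[TP /eqP TT]; have [_ _] := toggleP TP; rewrite TT => oP.
  by rewrite -signr_odd -[in RHS]signr_odd !oddD oP addbN signrN opprK.
by apply/eqP; rewrite -[S == 0]/((2 == 0)%N || (S == 0)) -mulrn_eq0 mulr2n {1}SN addNr.
Qed.

End Edge.

(** If [kappa] is proper, the first edge of a path between two points of a
    monochromatic connected block would be monochromatic, so all blocks are singletons;
    otherwise [toggle] at a monochromatic edge cancels the terms in pairs. *)
Lemma mono_sum : \sum_(P | mono_partition P) (-1) ^+ (#|V| + #|P|) =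
  [forall u, forall v, e u v ==> (kappa u != kappa v)]%:R :> int.
Proof.
have [/forallP kP|] := boolP [forall u, forall v, e u v ==> (kappa u != kappa v)]; last first.
  move=> /forallPn[u /forallPn[v]]; rewrite negb_imply negbK => /andP[uv /eqP kuv].
  exact: (mono_sum_eq0 uv kuv).
rewrite (big_pred1 [set [set x] | x in [set: V]]%SET) => [|P].
  rewrite card_imset; last exact: finset.set1_inj.
  by rewrite cardsT addnn -mul2n exprM sqrrN !expr1n.
rewrite /=; apply/mono_partitionP/eqP => [[Pp PB]|->].
  have /and3P[/eqP Pcov PtI P0] := Pp.
  have Bsing (B : {set V}) x : B \in P -> x \in B -> B = [set x]%SET.
    move=> BP xB; have [Bc Bk] := PB B BP; apply/setP => y; rewrite !inE.
    apply/idP/eqP => [yB|->//].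
    have /forall_inP/(_ y yB) /connectP[[|z p] /=] := forall_inP Bc x xB; first by move=> _ ->.
    move=> /andP[/and3P[_ zB exz] _] _.
    by have /forallP/(_ z) := kP x; rewrite exz (Bk x z) ?eqxx.
  apply/setP => B; apply/idP/imsetP => [BP|[x _ ->]].
    have /set0Pn[x xB] : B != finset.set0 by apply: contraNneq P0 => <-.
    by exists x; rewrite ?inE//; apply: Bsing.
  have xb : x \in pblock P x by rewrite mem_pblock Pcov inE.
  by rewrite -(Bsing (pblock P x))// pblock_mem// Pcov inE.
split.
  apply/and3P; split.
  - apply/eqP/setP => x; rewrite inE; apply/bigcupP; exists [set x]%SET; rewrite ?inE//.
    by apply: imset_f; rewrite inE.
  - apply/trivIsetP => _ _ /imsetP[x _ ->] /imsetP[y _ ->] xy.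
    by rewrite disjoints1 inE; apply: contraNneq xy => ->.
  - by apply/imsetP => -[x _ /setP/(_ x)]; rewrite !inE eqxx.
move=> _ /imsetP[x _ ->]; split; last by move=> y z; rewrite !inE => /eqP -> /eqP ->.
by apply/forall_inP => y; rewrite inE => /eqP ->; apply/forall_inP => z; rewrite inE => /eqP ->.
Qed.

End Toggle.

(** * The chromatic symmetric function in power sums *)

Section ConstantColorings.
Variables (V : finType) (I : finType) (R : comNzRingType) (x : I -> R).

(** Expanding the product of power sums chooses one color for each block. *)
Lemma constant_blocks_sum (P : {set {set V}}) (i0 : I) :
    finset.partition P [set: V]%SET ->
  \sum_(kappa : {ffun V -> I} | constant_blocks kappa P) \prod_v x (kappa v) =
  \prod_(B in P) psum x #|B|.
Proof.
move=> Pp; have /and3P[/eqP Pcov PtI P0] := Pp.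
have bP w : pblock P w \in P by rewrite pblock_mem// Pcov inE.
have wb w : w \in pblock P w by rewrite mem_pblock Pcov inE.
(* [h] and [g] identify the colorings constant on blocks with the choices of one
   color per block; a choice takes the value [i0] at sets that are not blocks. *)
rewrite /psum (big_distr_big i0) /=.
pose h (f : {ffun {set V} -> I}) : {ffun V -> I} := [ffun w => f (pblock P w)].
pose g (kappa : {ffun V -> I}) : {ffun {set V} -> I} :=
  [ffun B : {set V} => if B \in P then
     if [pick w in B] is Some w then kappa w else i0 else i0].
have pickB (B : {set V}) : B \in P -> exists2 w, w \in B & [pick w in B] = Some w.
  move=> BP; case: pickP => [w wB|B0]; first by exists w.
  by case/negP: P0; rewrite (_ : finset.set0 = B)//; apply/setP => w; rewrite B0 inE.
rewrite (reindex_onto h g) /=; last first.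
  move=> kappa /forall_inP kP; apply/ffunP => w; rewrite !ffunE bP.
  have [w' w'B ->] := pickB _ (bP w).
  by have /forall_inP/(_ w' w'B)/forall_inP/(_ w (wb w))/eqP := kP _ (bP w).
apply: eq_big => [f|f _].
  apply/andP/pffun_onP => [[_ /eqP fE]|[fs _]].
    split=> //; apply/subsetP => B; rewrite inE /= -fE ffunE.
    by case: ifP; rewrite ?eqxx.
  split.
    apply/forall_inP => B BP; apply/forall_inP => w wB; apply/forall_inP => w' w'B.
    by rewrite !ffunE (def_pblock PtI BP wB) (def_pblock PtI BP w'B).
  apply/eqP/ffunP => B; rewrite ffunE; case: ifPn => [BP|BP].
    by have [w wB ->] := pickB _ BP; rewrite ffunE (def_pblock PtI BP wB).
  apply/eqP; rewrite eq_sym; apply: contraNT BP => fB.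
  by apply: (subsetP fs); rewrite inE.
rewrite [LHS](eq_bigl (fun w => w \in [set: V]%SET)); last by move=> w; rewrite inE.
rewrite (set_partition_big _ Pp) /=; apply: eq_bigr => B BP.
rewrite (eq_bigr (fun=> x (f B))) ?prodr_const// => w wB.
by rewrite ffunE (def_pblock PtI BP wB).
Qed.

End ConstantColorings.

Section ChromaticPowerSums.
Variables (V : finType) (e : rel V) (n : nat).
Hypotheses (e_tree : is_tree e) (Vn : #|V| = n).
Variables (I : finType) (i0 : I) (R : comNzRingType) (x : I -> R).

(** The indicator of proper colorings is replaced by the sum over connected
    partitions of [mono_sum], and the two sums are exchanged. *)
Lemma chromatic_psum :
  \sum_(kappa : {ffun V -> I} | [forall u, forall v, e u v ==> (kappa u != kappa v)])
     \prod_v x (kappa v) =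
  \sum_(mu : intpartn n) (-1) ^+ (n + size mu) *
     (num_connected_partitions e mu)%:R * \prod_(k <- mu) psum x k.
Proof.
have [e_sym e_irr _ e_conn e_acyc] := e_tree.
transitivity (\sum_(P | connected_partition e P)
    (-1) ^+ (n + #|P|) * \prod_(B in P) psum x #|B|).
  rewrite big_mkcond /=.
  transitivity (\sum_(kappa : {ffun V -> I})
      \sum_(P | connected_partition e P && constant_blocks kappa P)
        (-1) ^+ (n + #|P|) * \prod_v x (kappa v)).
    apply: eq_bigr => kappa _; rewrite -mulr_suml.
    have := congr1 (fun z : int => z%:~R : R)
      (mono_sum e_sym e_irr e_conn e_acyc kappa).
    rewrite rmorph_sum /= Vn => E.
    have -> : \sum_(P | connected_partition e P && constant_blocks kappa P)
        (-1) ^+ (n + #|P|) =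
        [forall u, forall v, e u v ==> (kappa u != kappa v)]%:R :> R.
      rewrite rmorph_nat in E; rewrite -E; apply: eq_bigr => P _.
      by rewrite rmorphXn rmorphN1.
    by case: ifP => _; rewrite ?mul1r ?mul0r.
  rewrite (exchange_big_dep (connected_partition e)) /=; last by move=> kappa P _ /andP[].
  apply: eq_bigr => P Pc; rewrite Pc -mulr_sumr constant_blocks_sum//.
  by have /andP[] := Pc.
rewrite (sum_by_partn (n := n) (s := fun P : {set {set V}} => [seq #|B| | B : {set V} in P])).
  apply: eq_bigr => mu _; rewrite /num_connected_partitions.
  rewrite [_ * _%:R]mulrC -mulrA mulr_natl -sumr_const.
  apply: eq_big => [P|P /andP[_ Pmu]]; first by rewrite inE.
  by rewrite -(perm_big _ Pmu) big_image -(perm_size Pmu) size_image.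
move=> P _ /andP[/and3P[/eqP Pcov PtI P0] _]; split.
  by apply/negP => /imageP[B BP /esym/eqP]; rewrite cards_eq0 => /eqP B0; rewrite -B0 BP in P0.
by rewrite sumnE big_image /= (eqP PtI) Pcov cardsT.
Qed.

End ChromaticPowerSums.

(** * The elementary expansion *)

(** Each row has at least one brick; hence the truncated subtraction of the lengths
    is a true one. *)
Lemma brick_sizes_leq la mu t : splits la mu t -> 0%N \notin mu -> (size mu <= size la)%N.
Proof.
move=> /andP[/eqP <- /perm_size <-]; elim: t => //= r t IH.
rewrite inE negb_or size_cat => /andP[r0 /IH t_le].
by rewrite -[(size _).+1]add1n leq_add//; case: r r0.
Qed.

Lemma total_brick_weight_eq0 la mu : ~ refines la mu -> total_brick_weight la mu = 0.
Proof.
move=> nref; rewrite /total_brick_weight fsbig1// => t tt.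
by case: nref; exists t.
Qed.

Lemma chromatic_elem_expansion (V : finType) (e : rel V) n :
    is_tree e -> #|V| = n ->
  elem_expansion (chromatic_sym e)
    [ffun la : intpartn n => \sum_(mu : intpartn n | `[< refines la mu >])
       (-1) ^+ (size la - size mu)
       * (num_connected_partitions e mu)%:R * total_brick_weight la mu].
Proof.
move=> e_tree Vn m; have [N [{}m ->]] := cmon_of_surj m.
rewrite restricts_chromatic
  (chromatic_psum e_tree Vn ord0 (fun i : 'I_N.+1 => 'X_i : mpoly N.+1 int)).
under eq_bigr => mu _ do rewrite psum_esum mulr_sumr.
rewrite exchange_big /= [LHS]raddf_sum; apply: eq_bigr => la _ /=.
rewrite restricts_elem_sym_part ffunE -mcoeffZ; congr mcoeff.
rewrite scaler_suml [RHS]big_mkcond /=; apply: eq_bigr => mu _.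
rewrite mulrA; case: asboolP => [[t tP]|/total_brick_weight_eq0 ->]; last first.
  by rewrite mulr0 mulr0 mul0r.
rewrite -[RHS]mulr_algl.
have lemu := brick_sizes_leq tP (partn_notin0 mu).
congr (_ * _); rewrite -[X in _ = X%:A]intz scaler_int.
rewrite !rmorphM /= rmorphXn rmorphN1 rmorph_nat mulrACA mulrA -exprD.
congr (_ * _ * _).
have -> : (n + size mu + (n + size la) = (n + size mu).*2 + (size la - size mu))%N.
  by rewrite -addnn -!addnA subnKC// addnCA.
by rewrite exprD -mul2n exprM sqrrN !expr1n mul1r.
Qed.

Theorem theorem2p3 (V : finType) (T : rel V) (n : nat) (lambda : intpartn n)
    (hT : is_tree T) (hn : #|V| = n) :
  elem_coef (chromatic_sym T) lambda =
    \sum_(mu : intpartn n | `[< refines lambda mu >])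
       (-1) ^+ (size lambda - size mu)
       * (num_connected_partitions T mu)%:R * total_brick_weight lambda mu.
Proof.
have TE := chromatic_elem_expansion hT hn; rewrite /elem_coef.
case: xgetP => [c _ /= cE|nE]; last by case: (nE _ TE).
by rewrite (elem_expansion_uniq cE TE) ffunE.
Qed.
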